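(* Let $H=(V,E)$ be a connected hypergraph with $|V|\ge2$ and let $\Omega(H)$ be its multi-tree family. Then for any set of weights $\sigma\in\mathbb{R}^E_{>0}$, $$\operatorname{Mod}_{1,\sigma}(\Omega(H))=S_\sigma(H).$$
   Context: A hypergraph $H=(V,E)$ has a finite nonempty vertex set $V$ and a finite collection $E$ of subsets of $V$ (hyperedges), where repetitions are allowed (parallel hyperedges are distinct elements of $E$) and every hyperedge has at least two vertices. $H$ is connected if for every nonempty proper subset $X\subset V$ some hyperedge intersects both $X$ and $V\setminus X$. For a partition $\mathscr P$ of $V$ into nonempty parts, $|\mathscr P|$ is the number of parts and $\delta(\mathscr P)$ is the set of hyperedges intersecting at least two parts. For $F\subseteq E$, $\sigma(F)=\sum_{e\in F}\sigma(e)$. Weighted strength: $S_\sigma(H)=\min\left\{\frac{\sigma(\delta(\mathscr P))}{|\mathscr P|-1}:\mathscr P\text{ a partition of }V,\ |\mathscr P|\ge2\right\}$. A set (or multiset) $F$ of hyperedges is a hyperforest if for every nonempty $X\subseteq V$ at most $|X|-1$ members of $F$ (counted with multiplicity) are contained in $X$; a hypertree is a hyperforest with $|F|=|V|-1$. For a multiset $A$ from $E$, $H[A]$ is the hypergraph with vertex set $\bigcup_{e\in A}e$ and hyperedges the members of $A$ (copies being parallel hyperedges), and $x^A\in\mathbb{R}^E_{\ge0}$ has $x^A(e)$ equal to the multiplicity of $e$ in $A$. The multi-tree family $\Omega(H)$ is the set of all $x^A$ such that $H[A]$ is a hypertree with vertex set $V$. For a family $\Gamma\subset\mathbb{R}^E_{\ge0}$,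 $\operatorname{Adm}(\Gamma)=\{\rho\in\mathbb{R}^E_{\ge0}:\gamma^T\rho\ge1\ \forall\gamma\in\Gamma\}$ and $\operatorname{Mod}_{1,\sigma}(\Gamma)=\inf_{\rho\in\operatorname{Adm}(\Gamma)}\sum_{e\in E}\sigma(e)\rho(e)$. *)

(* Defs.v *)
From HB Require Import structures.
From mathcomp Require Import all_boot all_order all_algebra.
From mathcomp Require Import finmap multiset.
From mathcomp Require Import classical_sets reals constructive_ereal ereal.

Set Implicit Arguments.
Unset Strict Implicit.
Unset Printing Implicit Defensive.

Import Order.TTheory GRing.Theory Num.Theory.

Local Open Scope mset_scope.
Local Open Scope ring_scope.

(* The vertices form a finite set inside an ambient finite type, so that a
   hypergraph and the hypergraphs generated by its hyperedges share one type of
   vertices. Hyperedges are names of vertex sets, which allows parallel ones.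
   The empty vertex set is allowed here only so that [generated H A] is defined
   for the empty multiset A. *)
Record hypergraph (T : finType) := Hypergraph {
  vertices : {set T};
  hedge : finType;
  ends : hedge -> {set T};
  ends_sub : forall e, ends e \subset vertices;
  ends_card : forall e, (1 < #|ends e|)%N
}.

Section Hypergraphs.
Variables (T : finType).
Implicit Types (H : hypergraph T).

Definition connected_hypergraph H : Prop :=
  forall X : {set T}, (0 < #|X|)%N -> X \proper vertices H ->
    exists e : hedge H,
      (0 < #|ends e :&: X|)%N /\ (0 < #|ends e :&: (vertices H :\: X)|)%N.

Definition cut_edges H (P : {set {set T}}) : {set hedge H} :=
  [set e | (1 < #|[set B in P | (0 < #|ends e :&: B|)%N]|)%N]%SET.

Definition hyperforest H : Prop :=
  forall X : {set T}, X \subset vertices H -> (0 < #|X|)%N ->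
    (#|[set e : hedge H | ends e \subset X]%SET| <= #|X| - 1)%N.

Definition hypertree H : Prop :=
  hyperforest H /\ #|hedge H| = (#|vertices H| - 1)%N.

Section Generated.
Variables (H : hypergraph T) (A : {mset hedge H}).

(* The copies of e in A are the pairs (e, i) with i < A e. *)
Definition copies : finType := {e : hedge H & 'I_(A e)}.

Definition generated_vertices : {set T} :=
  (\bigcup_(e : hedge H | e \in A) ends e)%SET.

Lemma generated_sub (c : copies) : ends (tag c) \subset generated_vertices.
Proof.
apply: (@finset.bigcup_sup _ _ (tag c) (mem A) (fun e => ends e)).
by rewrite /= in_mset; case: c => e [i /= /(leq_ltn_trans (leq0n i))].
Qed.

Definition generated : hypergraph T :=
  Hypergraph generated_sub (fun c : copies => ends_card (tag c)).

End Generated.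

Section Weights.
Variables (R : realType) (H : hypergraph T).
Local Notation vec := {ffun hedge H -> R}.

(* The minimum ranges over finitely many partitions; +oo is its value over the
   empty range, which occurs only when H has at most one vertex. *)
Definition strength (sigma : vec) : \bar R :=
  \big[Order.min/+oo%E]_(P : {set {set T}} |
      finset.partition P (vertices H) && (2 <= #|P|)%N)
    ((\sum_(e in cut_edges H P) sigma e) / (#|P|%:R - 1))%:E.

Definition multiplicity (A : {mset hedge H}) : vec := [ffun e => (A e)%:R].

Definition multi_trees : set vec :=
  [set x | exists A : {mset hedge H},
     [/\ hypertree (generated A), vertices (generated A) = vertices H
       & x = multiplicity A]]%classic.

End Weights.
End Hypergraphs.

Arguments multi_trees {T} R H _.

Section Modulus.
Variables (R : realType) (E : finType).
Local Notation vec := {ffun E -> R}.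

Definition Adm (Gamma : set vec) : set vec :=
  [set rho | (forall e, 0 <= rho e) /\
     (forall gamma, Gamma gamma -> 1 <= \sum_e gamma e * rho e)]%classic.

Definition Mod1 (sigma : vec) (Gamma : set vec) : \bar R :=
  ereal_inf [set (\sum_e sigma e * rho e)%:E | rho in Adm Gamma]%classic.

End Modulus.

(* Main.v *)
(** Upper bound: for a partition P the density equal to 1/(|P|-1) on the cut and
    0 elsewhere is admissible, because a hypertree has at most |B|-1 edges inside
    each part B, hence at least |P|-1 edges in the cut.

    Lower bound: for a density rho, run Kruskal's algorithm on the values of rho.
    A hyperforest grows by a copy of the cheapest hyperedge e meeting two of its
    components, and e merges just two of the components that it meets (a hyperedge
    is thus used several times). The components at each level r form a partition
    whose cut contains only hyperedges with rho >= r, and it weighs at least the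
    strength times the number of components minus one; summing over the levels
    compares the strength times the rho-length of the final multi-tree with
    sigma . rho. *)

Require Import Defs.
From HB Require Import structures.
From mathcomp Require Import all_boot all_order all_algebra.
From mathcomp Require Import finmap multiset.
From mathcomp Require Import classical_sets reals constructive_ereal ereal.
From mathcomp Require Import ring lra.

Set Implicit Arguments.
Unset Strict Implicit.
Unset Printing Implicit Defensive.

Import Order.TTheory GRing.Theory Num.Theory.
Local Open Scope ring_scope.

(** * Partitions as fibres of colourings *)

Lemma preim_partition_imset (T : finType) (c : T -> T) (D : {set T}) :
  preim_partition c D = [set [set x in D | c x == y] | y in c @: D]%SET.
Proof.
rewrite -imset_comp /preim_partition /equivalence_partition.
by apply: eq_imset => x /=; apply/setP=> y; rewrite !inE eq_sym.
Qed.

Lemma fiber_inj (T : finType) (c : T -> T) (D : {set T}) :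
  {in c @: D &, injective (fun y => [set x in D | c x == y]%SET)}.
Proof.
move=> _ y /imsetP[x xD ->] _ /setP/(_ x).
by rewrite !inE xD eqxx /= => /esym/eqP.
Qed.

Lemma card_preim_partition (T : finType) (c : T -> T) (D : {set T}) :
  #|preim_partition c D| = #|c @: D|.
Proof. by rewrite preim_partition_imset (card_in_imset (@fiber_inj _ c D)). Qed.

Lemma card_preim_partition_meeting (T : finType) (c : T -> T) (D E : {set T}) :
  E \subset D ->
  #|[set B in preim_partition c D | (0 < #|E :&: B|)%N]%SET| = #|c @: E|.
Proof.
move=> sED.
have <- : #|[set [set x in D | c x == y] | y in c @: E]%SET| = #|c @: E|.
  by apply: card_in_imset => y z /(fintype.subsetP (imsetS c sED)) yD
    /(fintype.subsetP (imsetS c sED)) zD; apply: fiber_inj.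
congr #|pred_of_set _|; apply/setP => B; rewrite inE preim_partition_imset.
apply/andP/imsetP => [[/imsetP[y yD ->]] | [y /imsetP[x xE ->] ->]].
- case/card_gt0P=> x; rewrite !inE => /and3P[xE _ /eqP <-].
  by exists (c x); rewrite ?imset_f.
- split; first by apply: imset_f; apply: imset_f; apply: (fintype.subsetP sED).
  by apply/card_gt0P; exists x; rewrite !inE xE (fintype.subsetP sED) ?eqxx.
Qed.

(** Composing a colouring with this map merges two of its classes, as Kruskal's algorithm does with
    two components. *)
Definition recolour {T : eqType} (a b y : T) : T := if y == a then b else y.

Lemma card_recolour_imset (T : finType) (a b : T) (Y : {set T}) :
  a \in Y -> b \in Y -> a != b -> #|recolour a b @: Y|.+1 = #|Y|.
Proof.
move=> aY bY ab; rewrite (cardsD1 a Y) aY add1n; congr (_.+1).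
congr #|pred_of_set _|; apply/setP => z; rewrite !inE /recolour.
apply/imsetP/idP => [[y yY ->] | /andP[za zY]].
- by case: (eqVneq y a) => [_|ya]; rewrite ?yY ?ya // eq_sym ab bY.
- by exists z; rewrite ?(negbTE za).
Qed.

(** * Hyperforests grown along colourings *)

Section Hypergraphs.
Variables (T : finType) (H : hypergraph T).
Implicit Types (A : {mset hedge H}%mset) (c : T -> T) (X : {set T}).
Local Notation V := (vertices H).

Lemma card_copies A (p : pred (hedge H)) :
  #|[set x : copies A | p (tag x)]%SET| = (\sum_(e | p e) A e)%N.
Proof.
rewrite -sum1dep_card -(eq_bigl _ _ (fun x => andbT (p (tag x)))).
rewrite -(sig_big_dep p (fun _ => xpredT) (fun _ _ => 1%N)) /=.
by apply: eq_bigr => e _; rewrite sum1_card card_ord.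
Qed.

Lemma card_all_copies A : #|copies A| = (\sum_e A e)%N.
Proof.
by rewrite -(card_copies A xpredT) -cardsT; apply: eq_card => x; rewrite !inE.
Qed.

Definition crossing c (e : hedge H) := (1 < #|c @: ends e|)%N.

Lemma cut_edges_preim_partition c :
  cut_edges H (preim_partition c V) = [set e | crossing c e]%SET.
Proof.
by apply/setP => e; rewrite !inE card_preim_partition_meeting ?ends_sub.
Qed.

Lemma crossing_vertices c e : crossing c e -> (1 < #|c @: V|)%N.
Proof. by move/leq_trans; apply; apply/subset_leq_card/imsetS/ends_sub. Qed.

Lemma crossing_exists c : connected_hypergraph H ->
  (1 < #|c @: V|)%N -> exists e, crossing c e.
Proof.
move=> Hconn /card_gt1P[_ [_ [/imsetP[u uV ->] /imsetP[v vV ->] cuv]]].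
(* Connectivity is applied to a single colour class, which is proper because [v] has another
   colour. *)
have [||e []] := Hconn [set x in V | c x == c u]%SET.
- by apply/card_gt0P; exists u; rewrite !inE uV eqxx.
- apply/properP; split; first by apply/fintype.subsetP => x; rewrite inE => /andP[].
  by exists v => //; rewrite !inE vV eq_sym.
case/card_gt0P=> x; rewrite !inE => /and3P[xe _ /eqP cx].
case/card_gt0P=> y; rewrite !inE => /and3P[ye cy yV].
exists e; apply/card_gt1P; exists (c x), (c y); rewrite !imset_f //; split=> //.
by rewrite cx eq_sym; move: cy; rewrite yV.
Qed.

(* A is a hyperforest whose components are the colour classes of c. *)
Definition forest_colouring A c : Prop :=
  (forall X, X \subset V ->
    (\sum_(e | ends e \subset X) A e + #|c @: X| <= #|X|)%N) /\
  (\sum_e A e + #|c @: V| = #|V|)%N.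

Lemma sum_mset1D A e (p : pred (hedge H)) :
  (\sum_(f | p f) (e +` A)%mset f = p e + \sum_(f | p f) A f)%N.
Proof.
rewrite (eq_bigr (fun f => (f == e) + A f)%N); last by move=> f _; rewrite mset1DE.
rewrite big_split /=; congr (_ + _)%N.
rewrite -big_mkcondr /= sum1dep_card.
case pe: (p e); last first.
  apply/eqP; rewrite cards_eq0; apply/eqP/setP => f; rewrite !inE.
  by case: eqP => [->|]; rewrite ?pe ?andbF.
rewrite -[RHS](cards1 e); apply: eq_card => f; rewrite !inE.
by case: eqP => [->|]; rewrite ?pe ?andbF.
Qed.

(** A set [X] containing [e] sees both colours [a] and [b], so it loses exactly one colour, which
    pays for the new copy of [e]. Any other [X] gains no copy and no colour. *)
Lemma forest_colouring_recolour A c e a b : forest_colouring A c ->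
  a \in c @: ends e -> b \in c @: ends e -> a != b ->
  forest_colouring (e +` A)%mset (recolour a b \o c).
Proof.
move=> [fA tA] ae be ab.
have merged X : ends e \subset X -> #|(recolour a b \o c) @: X|.+1 = #|c @: X|.
  move=> /(imsetS c)/fintype.subsetP sX.
  by rewrite imset_comp card_recolour_imset ?sX.
split=> [X XV|]; last first.
  by rewrite sum_mset1D -tA -(merged V) ?ends_sub // add1n addSnnS.
rewrite sum_mset1D; have := fA X XV; case: (boolP (ends e \subset X)) => eX.
  by rewrite -(merged X eX) add1n addSnnS.
rewrite add0n; apply: leq_trans; rewrite leq_add2l imset_comp.
exact: leq_imset_card.
Qed.

Lemma forest_colouring_id : forest_colouring (mset0 : {mset hedge H}%mset) id.
Proof.
split=> [X _|]; rewrite big1 ?add0n ?imset_id // => e _; exact: mset0E.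
Qed.

Lemma forest_colouring_hypertree A c : (2 <= #|V|)%N ->
  forest_colouring A c -> #|c @: V| = 1%N ->
  hypertree (generated A) /\ vertices (generated A) = V.
Proof.
move=> V2 [fA tA] c1.
have tot : (\sum_e A e = #|V| - 1)%N by rewrite -tA c1 addnK.
have forest X : X \subset V -> (0 < #|X|)%N ->
    (\sum_(e | ends e \subset X) A e <= #|X| - 1)%N.
  move=> XV X0; rewrite leq_subRL // addnC; apply: leq_trans (fA X XV).
  by rewrite leq_add2l card_gt0 imset_eq0 -card_gt0.
have sW : generated_vertices A \subset V.
  by apply/bigcupsP => e _; exact: ends_sub.
(* All |V|-1 copies lie inside the generated vertex set W. The forest bound on W then forces |W| >=
   |V|, so the forest spans [V]. *)
have allW : (\sum_(e | ends e \subset generated_vertices A) A e = #|V| - 1)%N.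
  rewrite -tot [RHS](bigID (fun e => ends e \subset generated_vertices A)) /=.
  rewrite [X in (_ + X)%N]big1 ?addn0 // => e; apply: contraNeq.
  by rewrite -lt0n -in_mset => eA; apply: finset.bigcup_sup.
have WV : vertices (generated A) = V.
  apply/eqP; rewrite eqEcard sW /=.
  have [W0|W0] := posnP #|generated_vertices A|.
    move: (fA _ sW); rewrite W0 allW leqn0 addn_eq0 subn_eq0.
    by rewrite leqNgt V2.
  by have := forest _ sW W0; rewrite allW leq_sub2rE // card_gt0.
split=> //; split; last by rewrite WV -tot -card_all_copies.
move=> X; rewrite WV => XV X0.
by rewrite (card_copies A (fun e => ends e \subset X)) forest.
Qed.

(** * Hypertrees against partitions *)

Lemma uncut_edge_sub (P : {set {set T}}) e : finset.partition P V ->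
  e \notin cut_edges H P -> exists2 B, B \in P & ends e \subset B.
Proof.
move=> pP; rewrite inE -leqNgt => /card_le1_eqP one.
have meets x : x \in ends e -> finset.pblock P x \in
    [set B in P | (0 < #|ends e :&: B|)%N]%SET.
  move=> xe; have xP : x \in finset.cover P.
    by rewrite (cover_partition pP); apply: (fintype.subsetP (ends_sub e)).
  rewrite inE finset.pblock_mem //=; apply/card_gt0P; exists x.
  by rewrite inE xe finset.mem_pblock.
have /card_gt0P[x xe] : (0 < #|ends e|)%N by apply: ltnW (ends_card e).
exists (finset.pblock P x); first by have := meets x xe; rewrite inE => /andP[].
apply/fintype.subsetP => y ye; rewrite (one _ _ (meets y ye) (meets x xe)).
rewrite finset.mem_pblock (cover_partition pP).
exact: (fintype.subsetP (ends_sub e)).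
Qed.

Lemma leq_card_cut_edges A (P : {set {set T}}) :
  hypertree (generated A) -> vertices (generated A) = V ->
  finset.partition P V -> (#|P| <= \sum_(e in cut_edges H P) A e + 1)%N.
Proof.
move=> [fA tA] gV pP.
have inside : (\sum_(e | e \notin cut_edges H P) A e + #|P| <= #|V|)%N.
  rewrite (card_partition pP) -sum1_card.
  apply: leq_trans (_ : \sum_(B in P) (\sum_(e | ends e \subset B) A e + 1)
                        <= _)%N.
    rewrite big_split leq_add2r.
    (* After exchanging the sums, each uncut hyperedge is counted at least once, for the part that
       contains it. *)
    rewrite (exchange_big_dep xpredT) //= big_mkcond /=.
    apply: leq_sum => e _; case: ifP => // /(uncut_edge_sub pP)[B BP eB].
    by rewrite (bigD1 B) ?BP ?eB //= leq_addr.
  apply: leq_sum => B BP.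
  have B0 : (0 < #|B|)%N.
    by rewrite card_gt0; apply: contraTneq BP => ->; rewrite (finset.partition0 pP).
  have BV : B \subset vertices (generated A).
    by rewrite gV -(cover_partition pP); apply: finset.bigcup_sup.
  have := fA B BV B0; rewrite (card_copies A (fun e => ends e \subset B)).
  by rewrite leq_subRL // addnC.
(* The truncated |V|-1 is harmless: if [V] is empty, then so is [P]. *)
have [V0|V0] := posnP #|V|.
  by move: inside; rewrite V0 leqn0 addn_eq0 => /andP[_ /eqP ->].
have := tA; rewrite card_all_copies gV (bigID (fun e => e \in cut_edges H P)) /=.
move=> tot; move: inside.
by rewrite -(subnK V0) -tot [X in (_ <= X + _)%N]addnC -addnA leq_add2l.
Qed.

End Hypergraphs.

(** * The two bounds on the modulus *)

Section Modulus.
Variables (R : realType) (T : finType) (H : hypergraph T).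
Variable (sigma : {ffun hedge H -> R}).
Hypothesis sigma_ge0 : forall e, 0 <= sigma e.
Local Notation V := (vertices H).

Lemma cheap_multi_tree (s : R) (rho : hedge H -> R) :
  connected_hypergraph H -> (2 <= #|V|)%N -> (forall e, 0 <= rho e) ->
  (forall P : {set {set T}}, finset.partition P V -> (2 <= #|P|)%N ->
     s * (#|P|%:R - 1) <= \sum_(e in cut_edges H P) sigma e) -> 0 <= s ->
  exists2 x, multi_trees R H x &
    s * (\sum_e x e * rho e) <= \sum_e sigma e * rho e.
Proof.
move=> Hconn V2 rho0 hs s0.
(* Invariant of Kruskal's algorithm at level r with n+1 components left: the
   inequality to be proved holds for rho truncated at r on the crossing edges,
   where completing the tree will take n more edges. *)
suff greedy n : forall c (A : {mset hedge H}%mset) (r : R),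
    #|c @: V| = n.+1 -> forest_colouring A c ->
    (forall e, crossing c e -> r <= rho e) ->
    s * (\sum_e (A e)%:R * rho e + r * n%:R) <=
      \sum_e sigma e * (if crossing c e then r else rho e) ->
    exists2 x, multi_trees R H x &
      s * (\sum_e x e * rho e) <= \sum_e sigma e * rho e.
  apply: (greedy #|V|.-1 id mset0 0) => //.
  - by rewrite imset_id prednK // ltnW.
  - exact: forest_colouring_id.
  - rewrite big1 => [|e _]; last by rewrite mset0E mul0r.
    rewrite mul0r addr0 mulr0 sumr_ge0 // => e _.
    by apply: mulr_ge0 => //; case: ifP.
elim: n => [|n IH] c A r cn fA hr inv.
  exists (multiplicity R A).
    have [tA gA] := forest_colouring_hypertree V2 fA cn.
    by exists A.
  have nocross (e : hedge H) : crossing c e = false.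
    by apply/negbTE/negP => /crossing_vertices; rewrite cn.
  move: inv; rewrite mulr0 addr0.
  under [X in _ <= X]eq_bigr do rewrite nocross.
  by under [X in _ -> s * X <= _]eq_bigr do rewrite ffunE.
have [|e0 cross0] := crossing_exists Hconn (c := c); first by rewrite cn.
(* The cheapest crossing hyperedge sets the next level [rho e], which is at least [r]. *)
have [e /= crosse emin] := arg_minP rho cross0.
have /card_gt1P[a [b [ae be ab]]] := crosse.
have eV := fintype.subsetP (imsetS c (ends_sub e)).
have sub_cross (f : hedge H) : crossing (recolour a b \o c) f -> crossing c f.
  by move/leq_trans; apply; rewrite imset_comp leq_imset_card.
apply: (IH (recolour a b \o c) (e +` A)%mset (rho e)).
- by apply: succn_inj; rewrite imset_comp card_recolour_imset ?eV.
- exact: forest_colouring_recolour fA ae be ab.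
- by move=> f /sub_cross; exact: emin.
have cut : s * n.+1%:R <= \sum_(f | crossing c f) sigma f.
  have := hs _ (preim_partitionP c V); rewrite card_preim_partition cn.
  rewrite cut_edges_preim_partition -natr1 addrK => /(_ isT) /le_trans; apply.
  by under eq_bigl do rewrite inE.
have -> : \sum_f ((e +` A)%mset f)%:R * rho f =
    rho e + \sum_f (A f)%:R * rho f.
  rewrite (eq_bigr (fun f => (f == e)%:R * rho f + (A f)%:R * rho f)).
    rewrite big_split /= (bigD1 e) //= eqxx mul1r big1 ?addr0 // => f.
    by move/negbTE->; rewrite mul0r.
  by move=> f _; rewrite mset1DE natrD mulrDl.
(* First raise the level from [r] to [rho e], keeping [A] and [c]. The left side grows by
   [(rho e - r) * (s * n.+1%:R)], the right side by [rho e - r] times the weight of the cut, so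
   [cut] preserves the inequality. *)
have step : s * (\sum_f (A f)%:R * rho f + rho e * n.+1%:R) <=
    \sum_f sigma f * (if crossing c f then rho e else rho f).
  have -> : s * (\sum_f (A f)%:R * rho f + rho e * n.+1%:R) =
      s * (\sum_f (A f)%:R * rho f + r * n.+1%:R) +
      (rho e - r) * (s * n.+1%:R) by lra.
  apply: le_trans (lerD inv (ler_wpM2l _ cut)) _; first by rewrite subr_ge0 hr.
  rewrite mulr_sumr [X in _ + X]big_mkcond -big_split /=.
  by apply: ler_sum => f _; case: ifP => _; lra.
(* Then add [e]: its cost [rho e] is offset by one fewer edge still to come, so the left side is
   unchanged. *)
apply: le_trans (_ : s * (\sum_f (A f)%:R * rho f + rho e * n.+1%:R) <= _).
  by rewrite -natr1 le_eqVlt; apply/orP; left; apply/eqP; ring.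
(* The right side can only grow: a hyperedge that stops crossing goes from [rho e] up to its own
   [rho f]. *)
apply: le_trans step _; apply: ler_sum => f _; apply: ler_wpM2l => //.
have [crossf|/negP ncross] := boolP (crossing c f).
  by case: ifP => // _; exact: emin.
by case: ifP => // /sub_cross.
Qed.

Lemma Mod1_le_cut (P : {set {set T}}) :
  finset.partition P V -> (2 <= #|P|)%N ->
  (Mod1 sigma (multi_trees R H) <=
   ((\sum_(e in cut_edges H P) sigma e) / (#|P|%:R - 1))%:E)%E.
Proof.
move=> pP P2.
have P0 : 0 < #|P|%:R - 1 :> R by rewrite subr_gt0 ltr1n.
apply: ereal_inf_lbound => /=.
exists [ffun e => if e \in cut_edges H P then (#|P|%:R - 1)^-1 else 0].
  split=> [e|x [A [tA gA ->]]].
    by rewrite ffunE; case: ifP => // _; rewrite invr_ge0 ltW.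
  rewrite (eq_bigr (fun e => if e \in cut_edges H P
             then (A e)%:R / (#|P|%:R - 1) else 0)); last first.
    by move=> e _; rewrite !ffunE; case: ifP => // _; rewrite mulr0.
  rewrite -big_mkcond -mulr_suml ler_pdivlMr // mul1r lerBlDr -natr_sum.
  by rewrite natr1 ler_nat -addn1 leq_card_cut_edges.
congr (_%:E); rewrite mulr_suml [RHS]big_mkcond; apply: eq_bigr => e _.
by rewrite ffunE; case: ifP => // _; rewrite mulr0.
Qed.

End Modulus.

Theorem mainTheorem6 (R : realType) (T : finType) (H : hypergraph T)
    (Hconn : connected_hypergraph H) (HV : (2 <= #|vertices H|)%N)
    (sigma : {ffun hedge H -> R}) (sigma_gt0 : forall e, 0 < sigma e) :
  Mod1 sigma (multi_trees R H) = strength sigma.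
Proof.
have sigma_ge0 e : 0 <= sigma e by exact: ltW.
apply/eqP; rewrite eq_le; apply/andP; split.
  apply: le_bigmin => [|P /andP[pP P2]]; first exact: leey.
  exact: Mod1_le_cut.
have cut_ge0 (P : {set {set T}}) : (2 <= #|P|)%N ->
    0 < #|P|%:R - 1 :> R by move=> P2; rewrite subr_gt0 ltr1n.
have S0 : (0 <= strength sigma)%E.
  apply: le_bigmin => [|P /andP[_ P2]]; first exact: leey.
  by rewrite lee_fin divr_ge0 ?sumr_ge0 // ltW // cut_ge0.
have SP (P : {set {set T}}) : finset.partition P (vertices H) ->
    (2 <= #|P|)%N -> (strength sigma <=
    ((\sum_(e in cut_edges H P) sigma e) / (#|P|%:R - 1))%:E)%E.
  by move=> pP P2; apply: bigmin_le_cond; rewrite pP.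
(* The partition into singletons competes in the minimum, so the strength is not [+oo]. *)
have V2 : (2 <= #|preim_partition id (vertices H)|)%N.
  by rewrite card_preim_partition imset_id.
have := SP _ (preim_partitionP id _) V2.
case: (strength sigma) S0 SP => [s||] // s0 SP _.
apply/ereal_infP => _ [rho [rho0 adm] <-]; rewrite lee_fin.
have [||x xT xle] := @cheap_multi_tree R T H sigma sigma_ge0 s rho Hconn HV rho0.
- move=> P pP P2; have := SP P pP P2.
  by rewrite lee_fin ler_pdivlMr ?cut_ge0.
- by rewrite -lee_fin.
by apply: le_trans xle; rewrite -[leLHS]mulr1 ler_wpM2l ?adm // -lee_fin.
Qed.
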